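(* Let $X$ be a commutative additive group and let $\mathscr{S}_X:X\to[-\infty,\infty]$ be given. Let $d:X^2\to[-\infty,\infty]$ be the pseudo-distance induced by $\mathscr{S}_X$, namely $d(u,v):=\mathscr{S}_X(u-v)$ for all $u,v\in X$. Let $Y$ be an additive group and assume that $L:X\to Y$ is an additive operator which has an extended generalized inverse $\widetilde{L}:\widetilde{Y}\to X$ with domain $\widetilde{Y}$, where $\widetilde{Y}$ is an additive subgroup of $Y$ which satisfies $I:=L(X)\subseteq\widetilde{Y}$. Given $\mathscr{S}_{\widetilde{Y}}:\widetilde{Y}\to[-\infty,\infty]$, suppose that $\widetilde{L}$ is $\alpha$-Lipschitz continuous from $(\widetilde{Y},\mathscr{S}_{\widetilde{Y}})$ to $(X,\mathscr{S}_X)$ for some $0\neq\alpha\in\mathbb{R}$ (the case $\alpha=0$ is allowed too if $\mathscr{S}_{\widetilde{Y}}(y)\in\mathbb{R}$ for all $y\in\widetilde{Y}$). Denote $A_t:=\{x\in X:Lx=t\}$ for all $t\in I$. Then $$D_H(A_s,A_t)\leq\max\{\alpha\mathscr{S}_{\widetilde{Y}}(s-t),\ \alpha\mathscr{S}_{\widetilde{Y}}(t-s)\}\quad\text{for all } s,t\in I.$$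
   Context: Extended generalized inverse (EGI): let $L:X\to Y$ be an operator whose kernel $\{x\in X:Lx=0\}$ is nonempty, and let $\widetilde{Y}\subseteq Y$ contain the image $L(X)$. An extended generalized inverse of $L$ with domain $\widetilde{Y}$ is a (not necessarily additive) operator $\widetilde{L}:\widetilde{Y}\to X$ such that for all $t\in L(X)$ there are $v\in X$ and $a_{0,v}$ in the kernel of $L$ with $t=Lv$ and $\widetilde{L}(t)=v+a_{0,v}$. That $\widetilde{L}$ is $\alpha$-Lipschitz continuous from $(\widetilde{Y},\mathscr{S}_{\widetilde{Y}})$ to $(X,\mathscr{S}_X)$ means $\mathscr{S}_X(\widetilde{L}(u)-\widetilde{L}(v))\leq\alpha\,\mathscr{S}_{\widetilde{Y}}(u-v)$ for all $u,v\in\widetilde{Y}$. For $x\in X$ and nonempty $A,A'\subseteq X$: $d(x,A):=\inf\{d(x,a):a\in A\}$, $D_{asyH}(A,A'):=\sup\{d(a,A'):a\in A\}$, $D_H(A,A'):=\max\{D_{asyH}(A,A'),D_{asyH}(A',A)\}$, all in $[-\infty,\infty]$. No assumptions (symmetry, nonnegativity, finiteness, triangle inequality) are made on $\mathscr{S}_X$, $\mathscr{S}_{\widetilde{Y}}$ or $d$. An operator is additive if $L(x+y)=Lx+Ly$ for all $x,y\in X$. The group $Y$ is written additively but is not assumed commutative. *)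

(* Defs.v *)
From mathcomp Require Import all_boot all_order all_algebra.
From mathcomp Require Import all_classical all_reals all_analysis.

Set Implicit Arguments.
Unset Strict Implicit.
Unset Printing Implicit Defensive.

Import Order.TTheory GRing.Theory Num.Theory.
Local Open Scope classical_set_scope.
Local Open Scope ring_scope.
Local Open Scope ereal_scope.

Section Distances.
Context {R : realType}.

Definition induced_dist (X : zmodType) (S : X -> \bar R) : X -> X -> \bar R :=
  fun u v => S (u - v)%R.

Section SetDistances.
Context {X : Type}.
Variable d : X -> X -> \bar R.

Definition dist_set (x : X) (A : set X) : \bar R :=
  ereal_inf [set d x a | a in A].

Definition asym_Hausdorff (A A' : set X) : \bar R :=
  ereal_sup [set dist_set a A' | a in A].

Definition Hausdorff (A A' : set X) : \bar R :=
  maxe (asym_Hausdorff A A') (asym_Hausdorff A' A).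

End SetDistances.
End Distances.

(* A possibly noncommutative group is a groupType, which MathComp writes
   multiplicatively: for s, t in such a group, s + t, 0, -t and s - t are
   rendered (s * t)%g, 1%g, (t^-1)%g and (s / t)%g = (s * t^-1)%g. *)
Section Operators.
Context {X : zmodType} {Y : groupType}.

Definition additive_operator (L : X -> Y) : Prop :=
  {morph L : x y / (x + y)%R >-> (x * y)%g}.

Definition fiber (L : X -> Y) (t : Y) : set X := [set x | L x = t].

Definition op_kernel (L : X -> Y) : set X := fiber L 1%g.

(* Yt is the domain of the inverse, a subset of Y given as the subtype of the
   elements satisfying P. *)
Definition extended_generalized_inverse (P : pred Y) (Yt : subType P)
    (L : X -> Y) (Lt : Yt -> X) : Prop :=
  [/\ op_kernel L !=set0,
      range L `<=` range (val : Yt -> Y) &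
      forall t : Yt, range L (val t) ->
        exists v a0v : X,
          [/\ op_kernel L a0v, val t = L v & Lt t = (v + a0v)%R]].

End Operators.

Definition Lipschitz_operator {R : realType} {V : groupType} {X : zmodType}
    (alpha : R) (SV : V -> \bar R) (SX : X -> \bar R) (f : V -> X) : Prop :=
  forall u v : V, SX (f u - f v)%R <= alpha%:E * SV (u / v)%g.

(* Main.v *)
Require Import Defs.
From mathcomp Require Import all_boot all_order all_algebra.
From mathcomp Require Import all_classical all_reals all_analysis.

(** On the image of [L], an extended generalized inverse [Lt] is a selection of
    the fibers: [Lt s] differs from a preimage of [s] by a kernel element, so
    [L (Lt s) = s] ([extended_generalized_inverseK]). Nonempty fibers are cosets of
    the kernel, hence translation by [Lt t - Lt s] carries the fiber over [s]
    into the fiber over [t] ([fiber_translate]). It moves every point [x] by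
    the same vector, so the induced distance from [x] to its translate is
    [SX (Lt s - Lt t)], which the Lipschitz condition bounds by
    [alpha * SYt (s - t)] independently of [x]. Each asymmetric Hausdorff
    distance is thus bounded by testing the infimum on that single translate
    ([asym_Hausdorff_fiber_le]), and the theorem takes the larger of the bounds
    for [(s, t)] and [(t, s)]. *)

Set Implicit Arguments.
Unset Strict Implicit.
Unset Printing Implicit Defensive.

Import Order.TTheory GRing.Theory Num.Theory.
Local Open Scope classical_set_scope.
Local Open Scope ring_scope.
Local Open Scope ereal_scope.

Lemma extended_generalized_inverseK (X : zmodType) (Y : groupType)
    (L : X -> Y) (P : pred Y) (Yt : subType P) (Lt : Yt -> X) (t : Yt) :
  additive_operator L -> extended_generalized_inverse L Lt ->
  range L (val t) -> L (Lt t) = val t.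
Proof.
move=> hL [_ _ hLt] /hLt [v [a0v [ker_a0v -> ->]]].
by rewrite hL ker_a0v mulg1.
Qed.

(** Comparing [L x = L (x - u) * L u] with [L u] shows that [x - u] is in the
    kernel. The kernel term is kept on the left, so that right cancellation in
    the possibly noncommutative [Y] isolates it. *)
Lemma fiber_translate (X : zmodType) (Y : groupType) (L : X -> Y) (x u w : X) :
  additive_operator L -> L x = L u -> fiber L (L w) (x - u + w)%R.
Proof.
move=> hL Lxu; rewrite /fiber /= hL.
have -> : L (x - u)%R = 1%g.
  by apply: (mulIg (L u)); rewrite -hL subrK mul1g.
by rewrite mul1g.
Qed.

(** Each infimum is bounded by its value at a single point [y], so a bound
    uniform in [x] passes to the supremum. *)
Lemma asym_Hausdorff_le (R : realType) (X : Type) (d : X -> X -> \bar R)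
    (A B : set X) (c : \bar R) :
  (forall x, A x -> exists2 y, B y & d x y <= c) -> asym_Hausdorff d A B <= c.
Proof.
move=> near_B; apply: ge_ereal_sup => _ [x /near_B [y By dxy] <-].
by apply: le_trans dxy; apply: ereal_inf_lbound; exists y.
Qed.

(** The constant-displacement argument: the witness for [x] is its translate
    [x - Lt s + Lt t], at displacement [Lt s - Lt t]. *)
Lemma asym_Hausdorff_fiber_le (R : realType) (X : zmodType) (SX : X -> \bar R)
    (Y : groupType) (L : X -> Y) (P : pred Y) (Yt : subGroupType P)
    (Lt : Yt -> X) (SYt : Yt -> \bar R) (alpha : R) (s t : Yt) :
  additive_operator L -> extended_generalized_inverse L Lt ->
  Lipschitz_operator alpha SYt SX Lt ->
  range L (val s) -> range L (val t) ->
  asym_Hausdorff (induced_dist SX) (fiber L (val s)) (fiber L (val t))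
    <= alpha%:E * SYt (s / t)%g.
Proof.
move=> hL hLt hLip ims imt; apply: asym_Hausdorff_le => x Lxs.
have Ls := extended_generalized_inverseK hL hLt ims.
have Lt_t := extended_generalized_inverseK hL hLt imt.
exists (x - Lt s + Lt t)%R.
  by rewrite -Lt_t; apply: fiber_translate; rewrite // Ls.
rewrite /induced_dist.
have -> : (x - (x - Lt s + Lt t) = Lt s - Lt t)%R.
  by rewrite opprD opprB addrA (addrC x) subrK.
exact: hLip.
Qed.

Theorem lemma5p6 (R : realType) (X : zmodType) (SX : X -> \bar R)
    (Y : groupType) (L : X -> Y) (hL : additive_operator L)
    (P : pred Y) (Yt : subGroupType P) (Lt : Yt -> X)
    (hLt : extended_generalized_inverse L Lt)
    (SYt : Yt -> \bar R) (alpha : R)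
    (halpha : alpha <> 0%R \/ (forall y : Yt, SYt y \is a fin_num))
    (hLip : Lipschitz_operator alpha SYt SX Lt) :
  forall s t : Yt, range L (val s) -> range L (val t) ->
    Hausdorff (induced_dist SX) (fiber L (val s)) (fiber L (val t))
      <= maxe (alpha%:E * SYt (s / t)%g) (alpha%:E * SYt (t / s)%g).
Proof.
move=> s t ims imt; rewrite /Hausdorff ge_max; apply/andP; split.
  by rewrite le_max (asym_Hausdorff_fiber_le hL hLt hLip ims imt).
by rewrite le_max (asym_Hausdorff_fiber_le hL hLt hLip imt ims) orbT.
Qed.
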